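(* 1) Let $f$ be a piecewise contracting interval map with $N\geqslant 2$ contraction pieces which satisfies the separation property, let $x\in\widetilde X$ and let $\theta$ be the itinerary of $x$. Then there exist $\alpha\in\{0,1,\dots,N-1\}$, $\beta\geqslant 1$ and $m_0\geqslant 1$ such that \[ p(\theta,n)=\alpha n+\beta\qquad\forall\, n\geqslant m_0, \] with $\beta=1$ if $\alpha=N-1$. 2) For every $N\geqslant 2$ there exists a piecewise affine contracting interval map $f$ (i.e. $f$ is affine on each contraction piece) which has $N$ contraction pieces and satisfies the separation property, such that \[ p(\theta,n)=(N-1)n+1\qquad\forall\, n\geqslant 1 \] for every itinerary $\theta$ of $f$.
   Context: Let $(X,d)$ be a compact metric space and $X_1,\dots,X_N$ ($N\geqslant 2$) be non-empty pairwise disjoint open subsets of $X$ with $X=\bigcup_{i=1}^N\overline{X_i}$. Let $\Delta:=\{x\in\overline{X_i}\cap\overline{X_j}: i\neq j\}$. A map $f:X\to X$ is a piecewise contracting map with contraction pieces $X_1,\dots,X_N$ if $f$ is discontinuous at every point of $\Delta$ and there is $\lambda\in(0,1)$ such that $d(f(x),f(y))\leqslant\lambda d(x,y)$ for all $x,y$ in the same $X_i$. Then each $f|_{X_i}$ has a continuous extension $f_i:\overline{X_i}\to X$. The map $f$ satisfies the separation property if each $f_i$ is injective and $f_i(\overline{X_i})\cap f_j(\overline{X_j})=\emptyset$ for all $i\neq j$. A piecewise contracting interval map is a piecewise contracting map where $X$ is a compact interval of $\mathbb{R}$ and each contraction piece is an interval open in $X$. Let $\widetilde X:=\bigcap_{n\geqslant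 0}f^{-n}(X\setminus\Delta)$ (assumed non-empty). The itinerary of $x\in\widetilde X$ is the sequence $\theta=(\theta_t)_{t\in\mathbb{N}}\in\{1,\dots,N\}^{\mathbb{N}}$ with $\theta_t=i$ iff $f^t(x)\in X_i$; an itinerary of $f$ means the itinerary of some point of $\widetilde X$. For a sequence $\theta$ and $n\geqslant 1$, $L_n(\theta):=\{\theta_t\theta_{t+1}\dots\theta_{t+n-1}: t\geqslant 0\}$ and the complexity function is $p(\theta,n):=\#L_n(\theta)$. Here $\mathbb{N}=\{0,1,2,\dots\}$. *)

(* Defs.v *)
From Stdlib Require Import Reals.
From mathcomp Require Import all_boot.
From mathcomp Require Import boolp.

Set Implicit Arguments.
Unset Strict Implicit.
Unset Printing Implicit Defensive.

Local Open Scope R_scope.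

Definition Icc (a b : R) : R -> Prop := fun x => a <= x <= b.

(* Closure in R of a set S (X is closed, so this is also the closure in X). *)
Definition closureR (S : R -> Prop) : R -> Prop :=
  fun x => forall eps, 0 < eps -> exists y, S y /\ Rabs (y - x) < eps.

Definition open_in (Y S : R -> Prop) : Prop :=
  forall x, S x -> exists eps, 0 < eps /\
    forall y, Y y -> Rabs (y - x) < eps -> S y.

Definition is_interval (S : R -> Prop) : Prop :=
  forall x y z, S x -> S y -> x <= z <= y -> S z.

Definition cont_in (Y : R -> Prop) (g : R -> R) (x : R) : Prop :=
  forall eps, 0 < eps -> exists delta, 0 < delta /\
    forall y, Y y -> Rabs (y - x) < delta -> Rabs (g y - g x) < eps.

Definition Delta (N : nat) (P : 'I_N -> R -> Prop) : R -> Prop :=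
  fun x => exists i j : 'I_N, i <> j /\ closureR (P i) x /\ closureR (P j) x.

Definition pc_interval_map (a b : R) (N : nat) (P : 'I_N -> R -> Prop)
    (f : R -> R) : Prop :=
  a < b /\
  (forall x, Icc a b x -> Icc a b (f x)) /\
  (forall i, (exists x, P i x) /\ (forall x, P i x -> Icc a b x) /\
             is_interval (P i) /\ open_in (Icc a b) (P i)) /\
  (forall i j : 'I_N, i <> j -> forall x, P i x -> P j x -> False) /\
  (forall x, Icc a b x <-> exists i, closureR (P i) x) /\
  (forall x, Delta P x -> ~ cont_in (Icc a b) f x) /\
  (exists lam, 0 < lam < 1 /\
     forall i x y, P i x -> P i y -> Rabs (f x - f y) <= lam * Rabs (x - y)).

(* Separation property: the (unique) continuous extensions f_i of f|_{X_i}
   to the closures are injective and have pairwise disjoint images. *)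
Definition separation (N : nat) (P : 'I_N -> R -> Prop) (f : R -> R) : Prop :=
  exists g : 'I_N -> R -> R,
    (forall i x, P i x -> g i x = f x) /\
    (forall i x, closureR (P i) x -> cont_in (closureR (P i)) (g i) x) /\
    (forall i x y, closureR (P i) x -> closureR (P i) y -> g i x = g i y -> x = y) /\
    (forall i j : 'I_N, i <> j -> forall x y,
        closureR (P i) x -> closureR (P j) y -> g i x <> g j y).

Definition piecewise_affine (N : nat) (P : 'I_N -> R -> Prop) (f : R -> R) : Prop :=
  forall i, exists c d, forall x, P i x -> f x = c * x + d.

Definition Xtilde (a b : R) (N : nat) (P : 'I_N -> R -> Prop) (f : R -> R) :
  R -> Prop :=
  fun x => forall n : nat, Icc a b (iter n f x) /\ ~ Delta P (iter n f x).

Definition itinerary (N : nat) (P : 'I_N -> R -> Prop) (f : R -> R)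
    (x : R) (theta : nat -> 'I_N) : Prop :=
  forall t : nat, P (theta t) (iter t f x).

Definition Lang (N : nat) (theta : nat -> 'I_N) (n : nat) : {set n.-tuple 'I_N} :=
  [set w : n.-tuple 'I_N |
     `[< exists t : nat, forall k : 'I_n, tnth w k = theta (t + k)%N >]].

Definition complexity (N : nat) (theta : nat -> 'I_N) (n : nat) : nat :=
  #|Lang theta n|.

(* Main.v *)
Require Import Defs.
From Stdlib Require Import Reals Lra ZArith.
From mathcomp Require Import all_boot.
From mathcomp Require Import boolp zify.
From Coquelicot Require Import Hierarchy Continuity Series.

(** Part 1. Order the pieces from left to right. Call a letter [i] special of
    order [n] if some word [w] of length [n] of [theta] is followed both by [i]
    and by a letter on the left of [i]. The points of [X] whose past is [w] lie
    in an atom of [w], and by the separation property the atoms of the words of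
    length [n] are disjoint intervals; the atom of [w] contains the left end
    point of the piece [i], so [i] determines [w]. Hence [p (n+1) - p n] is the
    number of special letters of order [n]: it is at most [N - 1], since the
    leftmost letter is never special, and it does not increase with [n].

    Part 2. Let [M = N - 1] and [rho = sqrt 2 - 1]. The strictly increasing
    function [phi Y = sum_k 2^-k floor (Y - (k+1) rho)] satisfies
    [phi (Y + rho) = floor Y + phi Y / 2] and [phi (Y + 1) = phi Y + 2]; after
    the normalisation [Phi], it semiconjugates the rotation by [rho] on [R / M Z]
    to the contracting map [z |-> (z + floor z) / 2 + mu] modulo [M], which has [N]
    pieces on the interval [[mu, M - 1/2 + mu]] and is discontinuous at
    [1, ..., M]. As [Phi] is continuous at the integers, the density of the
    rotation orbits makes every orbit accumulate at [1, ..., M] from both sides.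
    Orbit points which are close have the same recent past, because the images of
    distinct pieces are at distance at least [1/4]; so all letters but the
    leftmost are special of every order. *)

Set Implicit Arguments.
Unset Strict Implicit.
Unset Printing Implicit Defensive.

(** * Complexity and special letters *)

Section Combinatorics.

Variables (N : nat) (theta : nat -> 'I_N) (rank : 'I_N -> nat).

Definition agree n t s := forall k, (k < n)%N -> theta (t + k) = theta (s + k).

Lemma agree_sym n t s : agree n t s -> agree n s t.
Proof. by move=> H k kn; rewrite H. Qed.

Lemma agree_trans n t s r : agree n t s -> agree n s r -> agree n t r.
Proof. by move=> H K k kn; rewrite H // K. Qed.

Lemma agreeS n t s :
  agree n.+1 t s <-> agree n t s /\ theta (t + n) = theta (s + n).
Proof.
split=> [H|[H e] k]; first by split=> [k kn|]; apply: H => //; lia.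
by rewrite ltnS leq_eqVlt => /orP[/eqP ->|/H].
Qed.

Definition word n t : n.-tuple 'I_N := [tuple theta (t + k) | k < n].

Lemma eq_word n t s : word n t = word n s <-> agree n t s.
Proof.
split=> [H k kn|H]; last by apply: eq_from_tnth => k; rewrite !tnth_mktuple H.
by move/(congr1 (fun w => tnth w (Ordinal kn))): H; rewrite !tnth_mktuple.
Qed.

Lemma LangP n (w : n.-tuple 'I_N) :
  reflect (exists t, w = word n t) (w \in Lang theta n).
Proof.
rewrite inE; apply: (iffP (asboolP _)) => -[t H]; exists t.
  by apply: eq_from_tnth => k; rewrite H tnth_mktuple.
by move=> k; rewrite H tnth_mktuple.
Qed.

Definition special n i :=
  exists t s, [/\ agree n t s, theta (t + n) = i &
                 (rank (theta (s + n)) < rank i)%N].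

Definition special_set n : {set 'I_N} := [set i | `[< special n i >]].

Lemma special_setP n i : reflect (special n i) (i \in special_set n).
Proof. by rewrite inE; apply: asboolP. Qed.

(** Dropping the first letter of the common past leaves a shorter common past. *)
Lemma special_setS n : special_set n.+1 \subset special_set n.
Proof.
apply/subsetP => i /special_setP [t [s [H e l]]]; apply/special_setP.
exists t.+1, s.+1; split; rewrite ?addSnnS // => k kn.
by rewrite !addSnnS H.
Qed.

Lemma card_special_set n : (#|special_set n| <= N - 1)%N.
Proof.
have [i0 _ hi0] := @arg_minnP _ (theta 0%N) xpredT rank isT.
have : special_set n \subset [set~ i0].
  apply/subsetP => i /special_setP [t [s [_ _ l]]]; rewrite !inE.
  by apply/eqP => e; move: (hi0 (theta (s + n)) isT); rewrite -e leqNgt l.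
by move/subset_leq_card; rewrite cardsC1 card_ord subn1.
Qed.

Lemma complexity0 : complexity theta 0 = 1%N.
Proof.
rewrite /complexity; apply/eqP/cards1P; exists (word 0 0).
apply/setP => w; rewrite in_set1 [RHS](_ : _ = true); first last.
  by apply/eqP; rewrite [LHS]tuple0 [RHS]tuple0.
by apply/LangP; exists 0%N; rewrite [LHS]tuple0 [RHS]tuple0.
Qed.

Hypothesis rank_inj : injective rank.

(** The dynamics enter the count here; [special_letter_past] supplies this for interval maps. *)
Hypothesis special_past : forall n t s t' s',
  agree n t s -> agree n t' s' -> theta (t + n) = theta (t' + n) ->
  (rank (theta (s + n)) < rank (theta (t + n)))%N ->
  (rank (theta (s' + n)) < rank (theta (t' + n)))%N -> agree n t t'.

(** Words of length [n.+1] are counted in two classes: those in [nonmin] by their last letter, the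
    others by their prefix, whose lowest extension they are. *)
Let nonmin n : {set n.+1.-tuple 'I_N} :=
  [set w | `[< exists t s, [/\ w = word n.+1 t, agree n t s &
                 (rank (theta (s + n)) < rank (theta (t + n)))%N] >]].

Let pre n (w : n.+1.-tuple 'I_N) : n.-tuple 'I_N :=
  [tuple tnth w (widen_ord (leqnSn n) k) | k < n].

Let pre_word n t : pre (word n.+1 t) = word n t.
Proof. by apply: eq_from_tnth => k; rewrite !tnth_mktuple. Qed.

Let last_word n t : tnth (word n.+1 t) ord_max = theta (t + n).
Proof. by rewrite tnth_mktuple. Qed.

Let card_nonmin n : #|nonmin n| = #|special_set n|.
Proof.
rewrite -(card_in_imset (f := fun w => tnth w ord_max) (D := mem (nonmin n))).
  congr #|pred_of_set _|; apply/setP => i; apply/imsetP/special_setP.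
    case=> w; rewrite inE => /asboolP [t [s [-> H l]]] ->.
    by exists t, s; rewrite last_word.
  case=> t [s [H e l]]; exists (word n.+1 t); last by rewrite last_word.
  by rewrite inE; apply/asboolP; exists t, s; rewrite e.
move=> w w'; rewrite !inE => /asboolP [t [s [-> H l]]].
move=> /asboolP [t' [s' [-> H' l']]]; rewrite !last_word => e.
by apply/eq_word/agreeS; split=> //; apply: special_past H H' e l l'.
Qed.

Let card_min n : #|Lang theta n.+1 :\: nonmin n| = #|Lang theta n|.
Proof.
rewrite -(card_in_imset (f := @pre n)
  (D := mem (Lang theta n.+1 :\: nonmin n))).
  congr #|pred_of_set _|; apply/setP => u; apply/imsetP/LangP.
    by case=> w /setDP [/LangP [t ->] _ ->]; exists t; rewrite pre_word.
  case=> t ->; pose Q i := `[< exists s, agree n t s /\ theta (s + n) = i >].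
  have Q0 : Q (theta (t + n)) by apply/asboolP; exists t.
  have [i /asboolP [s [H e]] m] := arg_minnP rank Q0.
  exists (word n.+1 s); last by rewrite pre_word; apply/eq_word.
  apply/setDP; split; first by apply/LangP; exists s.
  rewrite inE; apply/asboolP => -[s1 [s2 [/eq_word /agreeS [H1 e1] H2]]].
  rewrite -e1 e ltnNge m //; apply/asboolP; exists s2; split=> //.
  exact: agree_trans H (agree_trans H1 H2).
move=> w w' /setDP [/LangP [t ->] nt] /setDP [/LangP [s ->] ns].
rewrite !pre_word => /eq_word H; apply/eq_word/agreeS; split=> //.
apply: rank_inj; have [l|l|//] := ltngtP (rank (theta (t + n))) (rank (theta (s + n))).
  move: ns; rewrite inE => /asboolP; case; exists s, t.
  by split=> //; apply: agree_sym.
by move: nt; rewrite inE => /asboolP; case; exists t, s.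
Qed.

Lemma complexityS n :
  complexity theta n.+1 = (complexity theta n + #|special_set n|)%N.
Proof.
rewrite /complexity -(card_min n) -card_nonmin addnC.
rewrite -(cardsID (nonmin n) (Lang theta n.+1)); congr (_ + _)%N.
congr #|pred_of_set _|; apply/setIidPr/subsetP => w.
by rewrite inE => /asboolP [t [s [-> _ _]]]; apply/LangP; exists t.
Qed.

End Combinatorics.

(** * Sequences with nonincreasing increments *)

Lemma nonincr_stationary (u : nat -> nat) :
  (forall n, u n.+1 <= u n)%N ->
  exists m, (1 <= m)%N /\ forall n, (m <= n)%N -> u n = u m.
Proof.
move=> H.
have mono m n : (m <= n)%N -> (u n <= u m)%N.
  move/subnKC <-; elim: (n - m)%N => [|k]; rewrite ?addn0 // addnS.
  exact: leq_trans (H _).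
pose Q v := `[< exists m, (1 <= m)%N /\ u m = v >].
have Q1 : exists v, Q v by exists (u 1%N); apply/asboolP; exists 1%N.
case: (ex_minnP Q1) => v /asboolP [m [m1 <-]] hv; exists m; split=> // n mn.
apply/eqP; rewrite eqn_leq mono //=; apply: hv; apply/asboolP; exists n.
by split=> //; lia.
Qed.

(* [p] is concave with [p 0 = 1]: a final slope [alpha] forces an intercept at
   least [1], with equality if all the earlier slopes are maximal. *)
Lemma eventually_affine (p u : nat -> nat) (K : nat) :
  p 0%N = 1%N -> (forall n, p n.+1 = (p n + u n)%N) ->
  (forall n, u n.+1 <= u n)%N -> (forall n, u n <= K)%N ->
  exists alpha beta m0 : nat,
    (alpha <= K)%N /\ (1 <= beta)%N /\ (1 <= m0)%N /\
    (forall n, (m0 <= n)%N -> p n = (alpha * n + beta)%N) /\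
    (alpha = K -> beta = 1%N).
Proof.
move=> p0 pS dec uK; have [m [m1 hm]] := nonincr_stationary dec.
have ge n : (n <= m)%N -> (u m <= u n)%N.
  move/subnKC <-; elim: (m - n)%N => [|k]; rewrite ?addn0 // addnS.
  exact: leq_trans (dec _).
have lb n : (n <= m)%N -> (u m * n + 1 <= p n)%N.
  elim: n => [|n IH] nm; first by rewrite p0 muln0.
  by rewrite pS; have := IH (ltnW nm); have := ge n (ltnW nm); lia.
have ub n : (p n <= K * n + 1)%N.
  by elim: n => [|n IH]; rewrite ?p0 ?muln0 // pS; have := uK n; lia.
exists (u m), (p m - u m * m)%N, m; split=> //.
have lbm := lb m (leqnn m); split; first lia.
split=> //; split=> [n|e].
  move/subnKC <-; elim: (n - m)%N => [|k IH]; first by rewrite addn0; lia.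
  by rewrite addnS pS IH (hm (m + k)%N); lia.
by have := ub m; rewrite -e; lia.
Qed.

Local Open Scope R_scope.

(** * Atoms of a piecewise contracting interval map *)

Lemma subset_closureR (S : R -> Prop) x : S x -> closureR S x.
Proof.
by move=> Sx e e0; exists x; split=> //; rewrite Rminus_diag Rabs_R0.
Qed.

Lemma closureR_interval (S : R -> Prop) : is_interval S -> is_interval (closureR S).
Proof.
move=> HS x y z Hx Hy [xz zy] e e0.
have [<-|xz'] : x = z \/ x < z by lra.
  exact: Hx.
have [->|zy'] : z = y \/ z < y by lra.
  exact: Hy.
have [x' [Sx' dx]] := Hx (z - x) ltac:(lra).
have [y' [Sy' dy]] := Hy (y - z) ltac:(lra).
move: dx dy => /Rabs_def2 dx /Rabs_def2 dy.
exists z; split; last by rewrite Rminus_diag Rabs_R0.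
by apply: HS Sx' Sy' _; lra.
Qed.

Lemma image_interval (C A : R -> Prop) (h : R -> R) :
  is_interval A -> (forall x, A x -> C x) -> (forall x, C x -> cont_in C h x) ->
  is_interval (fun y => exists2 x, A x & h x = y).
Proof.
move=> HA AC hc y1 y2 y [x1 A1 <-] [x2 A2 <-] Hy.
pose u := Rmin x1 x2; pose v := Rmax x1 x2.
(* Precomposing with the retraction onto [[u, v]] makes [h] continuous on all of [R], as the
   intermediate value theorem requires. *)
pose cl z := Rmax u (Rmin z v).
have uv : u <= v.
  by rewrite /u /v; apply: Rle_trans (Rmin_l _ _) (Rmax_l _ _).
have Ain z : u <= z <= v -> A z.
  rewrite /u /v /Rmin /Rmax; case: Rle_dec => H Hz.
    exact: HA A1 A2 _.
  exact: HA A2 A1 _.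
have clin z : u <= cl z <= v.
  by rewrite /cl /Rmax /Rmin; do 2!case: Rle_dec; lra.
have cl_id z : u <= z <= v -> cl z = z.
  by rewrite /cl /Rmax /Rmin; do 2!case: Rle_dec; lra.
have cl_lip z z' : Rabs (cl z - cl z') <= Rabs (z - z').
  rewrite /cl /Rmin; do ?case: Rle_dec => ?;
  rewrite /Rmax; do ?case: Rle_dec => ?;
  by rewrite /Rabs; do ?case: Rcase_abs => ?; lra.
have hcont : continuity (fun z => h (cl z)).
  move=> z e e0; have [d [d0 Hd]] := hc _ (AC _ (Ain _ (clin z))) _ e0.
  exists d; split=> // z' [_ zz']; apply: Hd; first exact: AC (Ain _ (clin z')).
  exact: Rle_lt_trans (cl_lip _ _) zz'.
have e1 : cl x1 = x1 by apply: cl_id; split; [apply: Rmin_l|apply: Rmax_l].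
have e2 : cl x2 = x2 by apply: cl_id; split; [apply: Rmin_r|apply: Rmax_r].
case: (IVT_gen _ x1 x2 y hcont) => [|x [Hx <-]].
  by rewrite e1 e2 Rmin_left ?Rmax_right; lra.
by exists (cl x) => //; apply: Ain.
Qed.

Section Pieces.

Variables (a b : R) (N : nat) (P : 'I_N -> R -> Prop) (f : R -> R).
Hypothesis Hpc : pc_interval_map a b P f.

Let P_interval i : is_interval (P i).
Proof. by case: Hpc => _ [_ [/(_ i) [_ [_ []]]]]. Qed.

Let P_disj i j x : P i x -> P j x -> i = j.
Proof.
move=> Pi Pj; case: Hpc => _ [_ [_ [H _]]].
by case: (eqVneq i j) => // /eqP /H /(_ x Pi Pj).
Qed.

Lemma pieces_ordered : exists rank : 'I_N -> nat, injective rank /\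
  forall i j x y, (rank i < rank j)%N -> P i x -> P j y -> x < y.
Proof.
have /choice [q Pq] : forall i, exists x, P i x.
  by move=> i; case: Hpc => _ [_ [/(_ i) []]].
pose rank i := #|[set j | `[< q j < q i >]]|.
have rank_lt i j : q i < q j -> (rank i < rank j)%N.
  move=> lij; apply: proper_card; apply/properP; split.
    apply/subsetP => k; rewrite !inE => /asboolP lk; apply/asboolP; lra.
  by exists i; rewrite !inE; [apply/asboolP|apply/asboolP; lra].
have rank_gt i j : (rank i < rank j)%N -> q i < q j.
  move=> l; apply: Rnot_le_lt => -[/rank_lt|e]; first lia.
  by move: l; rewrite /rank e ltnn.
exists rank; split=> [i j e|i j x y l Px Py].
  case: (Rtotal_order (q i) (q j)) => [/rank_lt|[|/rank_lt]]; try lia.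
  by move=> eq; apply: (@P_disj i j (q i)) => //; rewrite eq.
apply: Rnot_le_lt => yx; have ql := rank_gt _ _ l.
suff e : i = j by rewrite e ltnn in l.
(* Whichever of [q i] and [y] is the larger lies in both pieces. *)
case: (Rle_lt_dec (q i) y) => h.
  by apply: (@P_disj _ _ y) => //; apply: (@P_interval i (q i) x).
by apply: (@P_disj _ _ (q i)) => //; apply: (@P_interval j y (q j)) => //; lra.
Qed.

Variable g : 'I_N -> R -> R.
Hypothesis gf : forall i x, P i x -> g i x = f x.
Hypothesis g_cont : forall i x,
  closureR (P i) x -> cont_in (closureR (P i)) (g i) x.
Hypothesis g_inj : forall i x y,
  closureR (P i) x -> closureR (P i) y -> g i x = g i y -> x = y.
Hypothesis g_sep : forall i j : 'I_N, i <> j -> forall x y,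
  closureR (P i) x -> closureR (P j) y -> g i x <> g j y.

Variables (x : R) (theta : nat -> 'I_N).
Hypothesis Ix : Icc a b x.
Hypothesis Hth : itinerary P f x theta.

(* The points of [X] with a past following the [n] letters of [theta] from
   position [t] on, the closed pieces being used. *)
Fixpoint atom t n : R -> Prop :=
  if n is m.+1 then fun y =>
    exists2 z, atom t m z /\ closureR (P (theta (t + m))) z
             & g (theta (t + m)) z = y
  else Icc a b.

Lemma atom_interval t n : is_interval (atom t n).
Proof.
elim: n => [|n IH] /=; first by rewrite /Icc => y1 y2 y /= ? ?; lra.
apply: (@image_interval (closureR (P (theta (t + n))))) => [|z []//|]; last first.
  exact: g_cont.
move=> y1 y2 y [h1 k1] [h2 k2] h; split; first exact: IH h1 h2 h.
exact: closureR_interval k1 k2 h.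
Qed.

Lemma orbit_atom t n : atom t n (iter (t + n) f x).
Proof.
elim: n => [|n IH] /=.
  rewrite addn0; elim: t => //= t IHt.
  by case: Hpc => _ [H _]; apply: H.
exists (iter (t + n) f x); last by rewrite addnS gf.
by split=> //; apply: subset_closureR.
Qed.

(** Separation lets the past be read backwards: disjoint images give the last letter, and
    injectivity gives the preimage. *)
Lemma atom_agree t s n y : atom t n y -> atom s n y -> agree theta n t s.
Proof.
elim: n y => // n IH y /= [z [Az Pz] ez] [z' [Az' Pz'] ez'].
have et : theta (t + n) = theta (s + n).
  case: (eqVneq (theta (t + n)) (theta (s + n))) => // /eqP ne.
  by case: (g_sep ne Pz Pz'); rewrite ez.
rewrite -et in Pz' ez'; apply/agreeS; split=> //; apply: (IH z) => //.
by rewrite (g_inj Pz Pz' (etrans ez (esym ez'))).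
Qed.

Lemma agree_atom t s n y : agree theta n t s -> atom t n y -> atom s n y.
Proof.
elim: n y => // n IH y /agreeS [H e] /= [z [Az Pz] <-].
by exists z; rewrite -?e //; split=> //; apply: IH.
Qed.

(* If the atoms of [t] and [t'] were distinct, hence disjoint, then one of them
   would have a point that belongs to a piece on the left of [P (theta (t + n))]
   and yet lies between two points of [P (theta (t + n))]. *)
Lemma special_letter_past (rank : 'I_N -> nat) :
  (forall i j y z, (rank i < rank j)%N -> P i y -> P j z -> y < z) ->
  forall n t s t' s',
  agree theta n t s -> agree theta n t' s' -> theta (t + n) = theta (t' + n) ->
  (rank (theta (s + n)) < rank (theta (t + n)))%N ->
  (rank (theta (s' + n)) < rank (theta (t' + n)))%N -> agree theta n t t'.
Proof.
move=> Hr n.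
have main t s t' s' : agree theta n t s -> agree theta n t' s' ->
  theta (t + n) = theta (t' + n) ->
  (rank (theta (s' + n)) < rank (theta (t' + n)))%N ->
  iter (t + n) f x <= iter (t' + n) f x -> agree theta n t t'.
  move=> H H' e l' le.
  have As' := agree_atom (agree_sym H') (orbit_atom s' n).
  have [h|h] := Rle_lt_dec (iter (s' + n) f x) (iter (t + n) f x).
    apply: (atom_agree (orbit_atom t n)).
    exact: atom_interval As' (orbit_atom t' n) _.
  have := Hth (t + n)%N; have := Hth (t' + n)%N; rewrite -e => Pt' Pt.
  have lt' : iter (s' + n) f x < iter (t' + n) f x by apply: Hr l' _ _.
  have Ps' : P (theta (t + n)) (iter (s' + n) f x).
    by apply: P_interval Pt Pt' _; lra.
  by rewrite (P_disj (Hth (s' + n)%N) Ps') e ltnn in l'.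
move=> t s t' s' H H' e l l'.
have [le|le] := Rle_lt_dec (iter (t + n) f x) (iter (t' + n) f x).
  exact: main H H' e l' le.
by apply: agree_sym; apply: (main t' s' t s) => //; lra.
Qed.

End Pieces.

(** * The semiconjugacy with a rotation *)

Definition floorR (r : R) : R := IZR (Int_part r).

Lemma floorR_itv r : floorR r <= r < floorR r + 1.
Proof. by have := base_Int_part r; rewrite /floorR; lra. Qed.

Lemma floorR_ge (n : Z) r : IZR n <= r -> IZR n <= floorR r.
Proof.
move=> h; apply: IZR_le; have := floorR_itv r; rewrite /floorR => h'.
have : IZR n < IZR (Int_part r + 1) by rewrite plus_IZR; lra.
by move/lt_IZR; lia.
Qed.

Lemma floorR_lt (n : Z) r : r < IZR n -> floorR r <= IZR n - 1.
Proof.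
move=> h; rewrite -minus_IZR; apply: IZR_le.
have : IZR (Int_part r) < IZR n by have := floorR_itv r; rewrite /floorR; lra.
by move/lt_IZR; lia.
Qed.

Lemma floorR_eq (n : Z) r : IZR n <= r < IZR n + 1 -> floorR r = IZR n.
Proof. by move=> h; rewrite /floorR -(Int_part_spec r n) //; lra. Qed.

Lemma floorR_le r s : r <= s -> floorR r <= floorR s.
Proof. by move=> h; apply: floorR_ge; have := floorR_itv r; rewrite /floorR; lra. Qed.

Lemma floorR_addZ (n : Z) r : floorR (r + IZR n) = floorR r + IZR n.
Proof.
rewrite /floorR -plus_IZR; apply: floorR_eq; rewrite plus_IZR.
by have := floorR_itv r; rewrite /floorR; lra.
Qed.

Lemma floorR_locally_constant r : (forall n, r <> IZR n) ->
  exists e0, 0 < e0 /\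
    forall e, 0 < e <= e0 -> floorR (r + e) = floorR (r - e).
Proof.
move=> nr; have [h1 h2] := floorR_itv r; have h3 := nr (Int_part r).
exists (Rmin (r - floorR r) (floorR r + 1 - r) / 2); rewrite -/(floorR r) in h3.
have [m1 m2] := (Rmin_l (r - floorR r) (floorR r + 1 - r),
                 Rmin_r (r - floorR r) (floorR r + 1 - r)).
split=> [|e he]; first by have := @Rmin_glb_lt (r - floorR r) (floorR r + 1 - r) 0; lra.
by rewrite !(@floorR_eq (Int_part r)) // -/(floorR r); lra.
Qed.

(** * Arithmetic of [rho] and density of the rotation *)

Definition rho : R := sqrt 2 - 1.

(** This relation turns the powers of [rho] into arbitrarily small integer combinations of [1] and
    [rho], which makes density explicit. *)
Lemma rho_sqr : rho * rho = 1 - 2 * rho.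
Proof. by rewrite /rho; have := sqrt_sqrt 2; lra. Qed.

Lemma rho_itv : 0 < rho < / 2.
Proof. by have := rho_sqr; have := sqrt_pos 2; rewrite /rho; nra. Qed.

(** For [k > 0] the 2-adic valuation is odd on the left and even on the right. *)
Lemma sqrt2_irr (k p : nat) : (2 * k ^ 2 = p ^ 2)%N -> k = 0%N.
Proof.
case: (posnP k) => // k0 e; have p0 : (0 < p)%N by case: p e => //; lia.
move/(congr1 (logn 2)): e; rewrite lognM ?expn_gt0 ?k0 // !lognX logn_prime //=.
by lia.
Qed.

Lemma rho_irr (k : nat) (m : Z) : (0 < k)%N -> INR k * rho <> IZR m.
Proof.
move=> k0 e.
have e2 : INR k * sqrt 2 = IZR (m + Z.of_nat k).
  by rewrite plus_IZR -INR_IZR_INZ -e /rho; ring.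
have e3 : IZR (2 * Z.of_nat k * Z.of_nat k) =
          IZR ((m + Z.of_nat k) * (m + Z.of_nat k)).
  rewrite !mult_IZR -e2 -!INR_IZR_INZ.
  by have := sqrt_sqrt 2 ltac:(lra) => h; rewrite -{1}h; ring.
move/eq_IZR: e3 => e3.
have := @sqrt2_irr k (Z.abs_nat (m + Z.of_nat k)); rewrite -!mulnn; lia.
Qed.

(** Odd exponents keep the coefficient of [rho] nonnegative, so that the combination is reached by
    forward rotations. The sign of [A] is what carries this through the induction. *)
Lemma rho_pow_odd n : exists (A : Z) (B : nat),
  (A <= 0)%Z /\ rho ^ (2 * n + 1) = IZR A + INR B * rho.
Proof.
elim: n => [|n [A [B [A0 e]]]]; first by exists 0%Z, 1%N; split=> //=; ring.
exists (A - 2 * Z.of_nat B)%Z, (Z.to_nat (5 * Z.of_nat B - 2 * A)).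
split; first lia.
rewrite (_ : (2 * n.+1 + 1)%N = (2 * n + 1).+2)%N; last lia.
change (rho ^ (2 * n + 1).+2) with (rho * (rho * rho ^ (2 * n + 1))).
rewrite e (INR_IZR_INZ (Z.to_nat _)) Z2Nat.id; last lia.
rewrite !minus_IZR !mult_IZR -INR_IZR_INZ.
have h := rho_sqr.
transitivity ((rho * rho) * (IZR A + INR B * rho)); first ring.
rewrite h; transitivity
  (IZR A + INR B * rho - 2 * rho * IZR A - 2 * INR B * (rho * rho)); first ring.
by rewrite h; ring.
Qed.

(** An odd power of [rho], times [M], is a positive step shorter than [v - u] that forward rotations
    realise modulo [M]. Starting from a translate of [Y] on the left of [u], such steps cannot jump
    over the target. *)
Lemma rotation_dense (M : nat) (u v Y : R) : (0 < M)%N -> u < v ->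
  exists (t : nat) (m : Z), u < Y + INR t * rho + IZR m * INR M < v.
Proof.
move=> M0 uv; have [r0 r1] := rho_itv.
have M1 : 1 <= INR M by apply: (le_INR 1); lia.
have [n Hn] := @pow_lt_1_zero rho ltac:(rewrite Rabs_pos_eq; lra)
  ((v - u) / INR M) ltac:(apply: Rdiv_lt_0_compat; lra).
have {Hn} := Hn (2 * n + 1)%N ltac:(lia).
have pw : 0 < rho ^ (2 * n + 1) by apply: pow_lt.
rewrite Rabs_pos_eq; last lra.
have [A [B [_ e]]] := rho_pow_odd n.
set s0 := rho ^ (2 * n + 1) in e pw *.
move/(Rmult_lt_compat_r (INR M) _ _ ltac:(lra)).
rewrite /Rdiv Rmult_assoc Rinv_l ?Rmult_1_r; last lra.
set s := s0 * INR M => sv.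
have s_gt0 : 0 < s by apply: Rmult_lt_0_compat; lra.
have [K1 K2] := archimed (Rabs (Y - u)); set K := up _ in K1 K2.
have K0 : 0 < IZR K by have := Rabs_pos (Y - u); lra.
pose Y0 := Y - IZR K * INR M.
have Yu : Y0 < u by have := Rle_abs (Y - u); rewrite /Y0; nra.
have [J1 J2] := archimed ((u - Y0) / s); set J := up _ in J1 J2.
have q0 : 0 < (u - Y0) / s by apply: Rdiv_lt_0_compat; lra.
have J0 : (0 < J)%Z by apply: lt_IZR; lra.
have qs : (u - Y0) / s * s = u - Y0 by field; lra.
exists (Z.to_nat J * M * B)%N, (J * A - K)%Z.
have -> : Y + INR (Z.to_nat J * M * B) * rho + IZR (J * A - K) * INR M = Y0 + IZR J * s.
  rewrite /s e /Y0 -!multE !mult_INR minus_IZR mult_IZR.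
  rewrite (INR_IZR_INZ (Z.to_nat J)) Z2Nat.id; last lia.
  ring.
by split; nra.
Qed.

(** * The semiconjugacy [Phi] and its generalised inverse *)

Lemma ex_series_phi Y :
  ex_series (fun k => (/ 2) ^ k * floorR (Y - INR k.+1 * rho)).
Proof.
have [r0 r1] := rho_itv.
(* The floors grow linearly in [k]; Bernoulli's inequality bounds this growth by a multiple of
   [(3/2)^k], and half of [3/2] is [3/4]. *)
apply: (@ex_series_le R_AbsRing R_CompleteNormedModule _
          (fun k => (Rabs Y + 2) * (3 / 4) ^ k)); last first.
  by apply: ex_series_scal_l; apply: ex_series_geom; rewrite Rabs_pos_eq; lra.
move=> k; change (Rabs ((/ 2) ^ k * floorR (Y - INR k.+1 * rho))
                  <= (Rabs Y + 2) * (3 / 4) ^ k).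
have p2 : 0 < (/ 2) ^ k by apply: pow_lt; lra.
rewrite Rabs_mult (Rabs_pos_eq ((/ 2) ^ k)); last lra.
have fl : Rabs (floorR (Y - INR k.+1 * rho)) <= Rabs Y + (INR k + 2).
  have := floorR_itv (Y - INR k.+1 * rho); rewrite S_INR.
  have := pos_INR k; have := Rle_abs Y; have := Rle_abs (- Y); rewrite Rabs_Ropp.
  by move=> ? ? ? ?; apply: Rabs_le; nra.
have b := @poly k (/ 2) ltac:(lra).
have e : (3 / 4) ^ k = (/ 2) ^ k * (1 + / 2) ^ k.
  by rewrite -Rpow_mult_distr; congr (_ ^ _); field.
have p3 : 1 <= (1 + / 2) ^ k by apply: pow_R1_Rle; lra.
have := Rabs_pos Y => Y0; rewrite e.
apply: (@Rle_trans _ ((/ 2) ^ k * ((Rabs Y + 2) * (1 + / 2) ^ k))); last lra.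
apply: Rmult_le_compat_l; first lra.
by nra.
Qed.

Definition phi (Y : R) : R :=
  Series (fun k => (/ 2) ^ k * floorR (Y - INR k.+1 * rho)).

Lemma phi_add_rho Y : phi (Y + rho) = floorR Y + phi Y / 2.
Proof.
rewrite {1}/phi Series_incr_1; last exact: ex_series_phi.
rewrite /Rdiv (Rmult_comm _ (/ 2)) /phi -Series_scal_l; congr (_ + _).
  by rewrite /= Rmult_1_l; congr floorR; ring.
apply: Series_ext => k; rewrite (S_INR k.+1) /= Rmult_assoc.
by do 2!congr (_ * _); congr floorR; ring.
Qed.

Lemma phi_add1 Y : phi (Y + 1) = phi Y + 2.
Proof.
have g : Rabs (/ 2) < 1 by rewrite Rabs_pos_eq; lra.
rewrite (_ : 2 = Series (fun k => (/ 2) ^ k)); last by rewrite Series_geom //; field.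
rewrite /phi -Series_plus; [|exact: ex_series_phi|exact: ex_series_geom].
apply: Series_ext => k.
rewrite (_ : Y + 1 - INR k.+1 * rho = Y - INR k.+1 * rho + IZR 1); last ring.
by rewrite floorR_addZ; ring.
Qed.

Lemma phi_le Y Z : Y <= Z -> phi Y <= phi Z.
Proof.
move=> YZ; suff : 0 <= phi Z - phi Y by lra.
rewrite /phi.
rewrite -Series_minus; try exact: ex_series_phi.
set d := fun n => _.
have <- : Series (fun _ => 0) = 0.
  rewrite -[RHS](Rmult_0_l (Series (fun _ => 0))) -Series_scal_l.
  by apply: Series_ext => k; rewrite Rmult_0_l.
apply: Series_le; last first.
  exact: ex_series_minus (ex_series_phi Z) (ex_series_phi Y).
move=> k; split; [lra|rewrite /d -Rmult_minus_distr_l].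
apply: Rmult_le_pos; first by apply: pow_le; lra.
suff: floorR (Y - INR k.+1 * rho) <= floorR (Z - INR k.+1 * rho) by lra.
by apply: floorR_le; lra.
Qed.

(** By density some [(t+1) * rho + m] lies between [Y] and [Z], and the term of index [t] jumps
    there. Rotating back [t] times brings that jump to the first term. *)
Lemma phi_lt Y Z : Y < Z -> phi Y < phi Z.
Proof.
move=> YZ; have [t [m]] := @rotation_dense 1 Y Z rho isT YZ.
rewrite Rmult_1_r => H.
have {H}: Y < INR t.+1 * rho + IZR m < Z by rewrite S_INR; lra.
have E W : phi W = floorR (W - rho) + phi (W - rho) / 2.
  by rewrite -phi_add_rho; congr phi; ring.
elim: t Y Z {YZ} => [|t IH] Y Z; rewrite ?S_INR (E Y) (E Z) => H.
  have h1 : Y - rho < IZR m by move: H => /=; lra.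
  have h2 : IZR m <= Z - rho by move: H => /=; lra.
  have := phi_le (Y := Y - rho) (Z := Z - rho) ltac:(lra).
  by have := floorR_lt h1; have := floorR_ge h2; lra.
have := IH (Y - rho) (Z - rho); rewrite S_INR => h; have := h ltac:(lra).
by have := @floorR_le (Y - rho) (Z - rho) ltac:(lra); lra.
Qed.

(** Normalised to fix [0] and commute with unit translations, so that floors break at the same
    integers on both sides of the semiconjugacy. *)
Definition Phi (Y : R) : R := (phi Y - phi 0) / 2.

Definition mu : R := Phi rho.

Lemma Phi_lt Y Z : Y < Z -> Phi Y < Phi Z.
Proof. by move/phi_lt; rewrite /Phi; lra. Qed.

Lemma Phi_lt_inv Y Z : Phi Y < Phi Z -> Y < Z.
Proof.
by move=> h; apply: Rnot_le_lt => -[/Phi_lt|e]; [|rewrite e in h]; lra.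
Qed.

Lemma Phi_add_rho Y : Phi (Y + rho) = (Phi Y + floorR Y) / 2 + mu.
Proof.
rewrite /mu /Phi -{2}(Rplus_0_l rho) !phi_add_rho (@floorR_eq 0 0); last lra.
by field.
Qed.

Lemma Phi_addn Y n : Phi (Y + INR n) = Phi Y + INR n.
Proof.
elim: n => [|n IH]; first by rewrite /= !Rplus_0_r.
by rewrite S_INR -!Rplus_assoc -IH /Phi phi_add1; field.
Qed.

Lemma Phi0 : Phi 0 = 0.
Proof. by rewrite /Phi; field. Qed.

Lemma Phi_INR n : Phi (INR n) = INR n.
Proof. by rewrite -(Rplus_0_l (INR n)) Phi_addn Phi0. Qed.

(* The jumps of [Phi] sit at the points [k * rho + m] with [k >= 1], none of
   which is an integer. *)
Lemma Phi_continuous0 d : 0 < d ->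
  exists e, 0 < e < rho /\ Phi e < d /\ - d < Phi (- e).
Proof.
move=> d0; have [r0 r1] := rho_itv.
(* Each backward rotation halves the gap of [Phi] across [0], as long as the floors on the two sides
   agree. The remaining gap is less than [1]. *)
have H n : exists e0, 0 < e0 /\ forall e, 0 < e <= e0 ->
    Phi e - Phi (- e) =
    (/ 2) ^ n * (Phi (e - INR n * rho) - Phi (- e - INR n * rho)).
  elim: n => [|n [e0 [e00 He0]]].
    by exists 1; split=> [|e _]; rewrite ?Rmult_0_l ?Rminus_0_r /=; lra.
  have [|e1 [e10 He1]] := @floorR_locally_constant (- (INR n.+1 * rho)).
    move=> m e; apply: (@rho_irr n.+1 (- m)) => //; rewrite opp_IZR; lra.
  exists (Rmin e0 e1); split=> [|e he]; first exact: Rmin_glb_lt.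
  have := Rmin_l e0 e1; have := Rmin_r e0 e1 => m1 m2.
  rewrite He0 /=; last lra.
  have E s : Phi (s - INR n * rho) =
      (Phi (s - INR n.+1 * rho) + floorR (s - INR n.+1 * rho)) / 2 + mu.
    by rewrite -Phi_add_rho S_INR; congr Phi; ring.
  rewrite !E; have := He1 e ltac:(lra).
  rewrite -/(INR n.+1) (Rplus_comm _ e) (_ : _ - e = - e - INR n.+1 * rho); last ring.
  by rewrite (_ : e + _ = e - INR n.+1 * rho); [move=> ->; field|ring].
have [n Hn] := @pow_lt_1_zero (/ 2) ltac:(rewrite Rabs_pos_eq; lra) d d0.
have {Hn} := Hn n (Nat.le_refl n); rewrite Rabs_pos_eq; last by apply: pow_le; lra.
move=> hn; have [e0 [e00 He0]] := H n.
pose e := Rmin e0 (rho / 2).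
have e_gt0 : 0 < e by apply: Rmin_glb_lt; lra.
have [m1 m2] := (Rmin_l e0 (rho / 2), Rmin_r e0 (rho / 2)).
exists e; split; first by rewrite /e in e_gt0 *; lra.
have := He0 e ltac:(rewrite /e in e_gt0 *; lra).
have : Phi (e - INR n * rho) < Phi (- e - INR n * rho + INR 1).
  by apply: Phi_lt; rewrite /= /e; lra.
rewrite Phi_addn /=.
have : 0 < (/ 2) ^ n by apply: pow_lt; lra.
have := @Phi_lt 0 e e_gt0; have := @Phi_lt (- e) 0 ltac:(lra); rewrite Phi0.
by move=> ? ? ? ? ?; nra.
Qed.

(** These bounds put the ends [mu] and [M - 1/2 + mu] inside the first and the last unit cell,
    whence [M + 1] pieces. The lower one comes from a point just left of [0], where the floor is
    [-1]. *)
Lemma mu_itv : / 2 < mu < 1.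
Proof.
have [r0 r1] := rho_itv; split; last first.
  by have := @Phi_lt rho (INR 1); rewrite Phi_INR /= /mu; lra.
have := @Phi_lt 0 (- (rho / 2) + rho) ltac:(lra).
rewrite Phi_add_rho Phi0 (@floorR_eq (-1)); last lra.
by have := @Phi_lt (- (rho / 2)) 0 ltac:(lra); rewrite Phi0; lra.
Qed.

(** A generalised inverse of [Phi]: a point in a gap of its range has no preimage, but is still
    tracked by the place where [Phi] jumps across it. *)
Definition shadows (z Y : R) : Prop :=
  (forall Y', Y' < Y -> Phi Y' < z) /\ (forall Y', Y < Y' -> z < Phi Y').

Lemma shadows_Phi Y : shadows (Phi Y) Y.
Proof. by split=> Y'; apply: Phi_lt. Qed.

Lemma shadows_le z Y Y' : shadows z Y -> Phi Y' <= z -> Y' <= Y.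
Proof.
move=> [_ h] l; apply: Rnot_lt_le => l'.
have := h ((Y + Y') / 2) ltac:(lra).
by have := @Phi_lt ((Y + Y') / 2) Y' ltac:(lra); lra.
Qed.

Lemma shadows_ge z Y Y' : shadows z Y -> z <= Phi Y' -> Y <= Y'.
Proof.
move=> [h _] l; apply: Rnot_lt_le => l'.
have := h ((Y + Y') / 2) ltac:(lra).
by have := @Phi_lt Y' ((Y + Y') / 2) ltac:(lra); lra.
Qed.

Lemma shadows_subn z Y n : shadows z Y -> shadows (z - INR n) (Y - INR n).
Proof.
move=> [h1 h2]; split=> Y' l.
  by have := h1 (Y' + INR n) ltac:(lra); rewrite Phi_addn; lra.
by have := h2 (Y' + INR n) ltac:(lra); rewrite Phi_addn; lra.
Qed.

Lemma nat_floorR z : 0 <= z -> exists n, floorR z = INR n /\ INR n <= z < INR n + 1.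
Proof.
move=> z0; have := floorR_itv z; have := @floorR_ge 0 z z0; rewrite /floorR => h0 h.
exists (Z.to_nat (Int_part z)); rewrite INR_IZR_INZ Z2Nat.id //.
exact: le_IZR.
Qed.

(** Since [Phi] fixes the integers, comparing [z] with values of [Phi] also compares the floors. *)
Lemma shadows_step z Y : 0 <= z -> shadows z Y ->
  shadows ((z + floorR z) / 2 + mu) (Y + rho).
Proof.
move=> z0 [h1 h2]; have [n [-> hn]] := nat_floorR z0.
split=> Y' l; rewrite -(Rplus_0_r Y') -(Rplus_opp_l rho) -Rplus_assoc Phi_add_rho.
  have h := h1 (Y' + - rho) ltac:(lra).
  have : Y' + - rho < INR n.+1 by apply: Phi_lt_inv; rewrite Phi_INR S_INR; lra.
  by rewrite INR_IZR_INZ => /floorR_lt; rewrite -INR_IZR_INZ S_INR; lra.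
have h := h2 (Y' + - rho) ltac:(lra).
have : INR n < Y' + - rho by apply: Phi_lt_inv; rewrite Phi_INR; lra.
by rewrite INR_IZR_INZ => /Rlt_le /floorR_ge; rewrite -INR_IZR_INZ; lra.
Qed.

Lemma shadows_exists (n : nat) z : 0 <= z <= INR n -> exists Y, shadows z Y.
Proof.
move=> [z0 zn].
have [||Y [ub lub]] := completeness (fun Y => Phi Y <= z).
- exists (INR n) => Y h; apply: Rnot_lt_le => /Phi_lt; rewrite Phi_INR; lra.
- by exists 0; rewrite Phi0.
exists Y; split=> Y' l.
  apply: Rnot_le_lt => h; suff : Y <= Y' by lra.
  by apply: lub => Y'' h''; apply: Rnot_lt_le => /Phi_lt; lra.
by apply: Rnot_le_lt => /ub; lra.
Qed.

(** * The affine example *)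

Lemma ltn_INR (i j : nat) : (i < j)%N -> INR i + 1 <= INR j.
Proof. by move=> h; rewrite -S_INR; apply: le_INR; lia. Qed.

Section Example.

Variable M : nat.
Hypothesis M_gt0 : (0 < M)%N.

(** The left limit of the map at [M], whereas its value at [M] is the other end [mu]. *)
Definition ex_b : R := INR M - / 2 + mu.

Definition ex_piece (i : 'I_M.+1) (z : R) : Prop :=
  Icc mu ex_b z /\ INR i < z < INR i + 1.

Definition ex_map (z : R) : R :=
  (z + floorR z) / 2 + mu - (if Rle_dec (INR M) z then INR M else 0).

Definition ex_branch (i : 'I_M.+1) (z : R) : R :=
  (z + INR i) / 2 + mu - (if i == M :> nat then INR M else 0).

Let M_ge1 : 1 <= INR M.
Proof. by have := ltn_INR M_gt0; rewrite /=; lra. Qed.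

Let INR_le_M (i : 'I_M.+1) : INR i <= INR M.
Proof. by apply: le_INR; have := ltn_ord i; lia. Qed.

Let floorR_INR n z : INR n <= z < INR n + 1 -> floorR z = INR n.
Proof. by rewrite INR_IZR_INZ => /floorR_eq. Qed.

Lemma ex_branchE (i : 'I_M.+1) z : ex_piece i z -> ex_branch i z = ex_map z.
Proof.
move=> [_ h]; rewrite /ex_branch /ex_map (@floorR_INR i); last lra.
case: eqP h => [->|ne] h; case: Rle_dec => h' /=; try lra.
have iM : (i < M)%N by rewrite ltn_neqAle -ltnS ltn_ord andbT; apply/eqP.
by have := ltn_INR iM; lra.
Qed.

Lemma ex_piece_nonempty i : exists z, ex_piece i z.
Proof.
have := mu_itv; have := INR_le_M i; rewrite /ex_piece /ex_b /Icc => iM hmu.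
have [i0|i0] := posnP i; first by exists mu; rewrite i0 /=; lra.
exists (INR i + mu - / 2); have := ltn_INR i0; rewrite /=; lra.
Qed.

Lemma closure_ex_piece i z :
  closureR (ex_piece i) z <-> Icc mu ex_b z /\ INR i <= z <= INR i + 1.
Proof.
split=> [h|[hz hi] e e0].
  have K (e : R) : 0 < e -> exists y, ex_piece i y /\ - e < y - z < e.
    by move=> /h [y [Py /Rabs_def2 hy]]; exists y; split=> //; lra.
  have lb c : (forall y, ex_piece i y -> c <= y) -> c <= z.
    move=> hc; apply: Rnot_lt_le => l.
    by have [y [/hc]] := K (c - z) ltac:(lra); lra.
  have ub c : (forall y, ex_piece i y -> y <= c) -> z <= c.
    move=> hc; apply: Rnot_lt_le => l.
    by have [y [/hc]] := K (z - c) ltac:(lra); lra.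
  by split; split; (apply: lb || apply: ub) => y; rewrite /ex_piece /Icc; lra.
(* By convexity, moving [z] slightly towards a point [w] of the piece enters the piece. *)
have [w [hw hiw]] := ex_piece_nonempty i.
pose t := Rmin (e / 2) (/ 2).
have t0 : 0 < t by apply: Rmin_glb_lt; lra.
have t1 : t <= e / 2 by apply: Rmin_l.
have t2 : t <= / 2 by apply: Rmin_r.
exists (z + t * (w - z)); split; last by apply: Rabs_def1; nra.
by move: hw hz; rewrite /ex_piece /Icc; split; nra.
Qed.

(** The value [1/4] is attained: the last branch sends [ex_b] to [3 mu / 2 - 1/4], and the first one
    sends [mu] to [3 mu / 2]. Images of the other branches than the last are at least [1/2]
    apart. *)
Lemma ex_branch_sep (i j : 'I_M.+1) y z : i <> j ->
  closureR (ex_piece i) y -> closureR (ex_piece j) z ->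
  / 4 <= Rabs (ex_branch i y - ex_branch j z).
Proof.
have hmu := mu_itv.
have main (i' j' : 'I_M.+1) y' z' : (i' < j')%N ->
    closureR (ex_piece i') y' -> closureR (ex_piece j') z' ->
    / 4 <= Rabs (ex_branch i' y' - ex_branch j' z').
  rewrite !closure_ex_piece /Icc /ex_b /ex_branch => l [y1 y2] [z1 z2].
  have l' := ltn_INR l; have jM := INR_le_M j'.
  have -> : (i' == M :> nat) = false.
    by apply/eqP => e; have := ltn_ord j'; lia.
  case: eqP => ej; last by rewrite Rabs_left1; lra.
  rewrite ej in l' z2 *; rewrite Rabs_pos_eq; first last.
    by have := pos_INR i'; lra.
  by have := pos_INR i'; lra.
move=> ne hy hz; have [l|l|e] := ltngtP i j; first exact: main.
  by rewrite Rabs_minus_sym; apply: main.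
by case: ne; apply: val_inj.
Qed.

Lemma ex_map_Icc z : Icc mu ex_b z -> Icc mu ex_b (ex_map z).
Proof.
have hmu := mu_itv; rewrite /Icc /ex_b /ex_map => hz.
have [|n [-> hn]] := @nat_floorR z; first lra.
case: Rle_dec => h /=.
  have -> : INR n = INR M.
    rewrite -(@floorR_INR n z) // (@floorR_INR M) //; lra.
  lra.
have nM : (n < M)%N.
  by rewrite ltnNge; apply/negP => Mn; have := le_INR M n ltac:(lia); lra.
by have := ltn_INR nM; have := pos_INR n; lra.
Qed.

Lemma ex_Delta z : Defs.Delta ex_piece z ->
  Icc mu ex_b z /\ exists j : nat, (0 < j <= M)%N /\ z = INR j.
Proof.
move=> [i [j [ne]]]; rewrite !closure_ex_piece => -[[hz hi] [_ hj]].
split=> //; have [l|l|e] := ltngtP i j; last by case: ne; apply: val_inj.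
  exists j; have := ltn_INR l; have := ltn_ord j.
  by split; [lia|lra].
exists i; have := ltn_INR l; have := ltn_ord i.
by split; [lia|lra].
Qed.

Lemma ex_pc_interval_map : pc_interval_map mu ex_b ex_piece ex_map.
Proof.
have hmu := mu_itv.
split; first by rewrite /ex_b; lra.
split; first exact: ex_map_Icc.
split.
  move=> i; split; first exact: ex_piece_nonempty.
  split; first by move=> z [].
  split; first by rewrite /ex_piece /Icc => x y z /= ? ?; lra.
  move=> z [hz hi]; exists (Rmin (z - INR i) (INR i + 1 - z)).
  have [m1 m2] := (Rmin_l (z - INR i) (INR i + 1 - z),
                   Rmin_r (z - INR i) (INR i + 1 - z)).
  split; first by apply: Rmin_glb_lt; lra.
  by move=> y hy /Rabs_def2 h; split=> //; lra.
split.
  move=> i j ne z Pi Pj.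
  have := ex_branch_sep ne (subset_closureR Pi) (subset_closureR Pj).
  by rewrite !ex_branchE // Rminus_diag Rabs_R0; lra.
split.
  move=> z; split=> [hz|[i /closure_ex_piece []//]].
  have [|n [_ hn]] := @nat_floorR z; first by move: hz; rewrite /Icc; lra.
  have nM : (n < M.+1)%N.
    rewrite ltnNge; apply/negP => Mn; have := le_INR M.+1 n ltac:(lia).
    by rewrite S_INR; move: hz; rewrite /Icc /ex_b; lra.
  by exists (Ordinal nM); apply/closure_ex_piece; split=> //=; lra.
split; last first.
  exists (/ 2); split; first lra.
  move=> i x y Px Py; rewrite -!(@ex_branchE i) // /ex_branch.
  by rewrite -(Rabs_pos_eq (/ 2)) -?Rabs_mult; [apply: Req_le; congr Rabs; field|lra].
move=> z /ex_Delta [hz [j [/andP [j0 jM] ez]]] /(_ (/ 4)) [|d [d0 H]]; first lra.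
(* The jump at [j] is [1/2], or [M - 1/2] if [j = M]. The second bound keeps [z - t] in the interval
   and the difference of the values above [1/4]. *)
pose t := Rmin (d / 2) ((1 - mu) / 2).
have t0 : 0 < t by apply: Rmin_glb_lt; lra.
have t1 : t <= d / 2 by apply: Rmin_l.
have t2 : t <= (1 - mu) / 2 by apply: Rmin_r.
have j1 : 1 <= INR j by have := ltn_INR j0; rewrite /=; lra.
have jM' : INR j <= INR M by apply: le_INR; lia.
have := H (z - t); rewrite /Icc /ex_map; move: hz; rewrite /Icc => hz.
have ej : INR j = INR j.-1 + 1 by rewrite -S_INR prednK.
rewrite (@floorR_INR j z) ?(@floorR_INR j.-1 (z - t)); try lra.
move=> /(_ ltac:(lra)) h; have := h ltac:(apply: Rabs_def1; lra).
case: Rle_dec => h1 /=; first lra.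
by case: Rle_dec => h2 /= /Rabs_def2; lra.
Qed.

Lemma ex_branch_cont i z : closureR (ex_piece i) z ->
  cont_in (closureR (ex_piece i)) (ex_branch i) z.
Proof.
move=> _ e e0; exists e; split=> // y _ /Rabs_def2 h.
by apply: Rabs_def1; rewrite /ex_branch; lra.
Qed.

Lemma ex_branch_inj i y z : closureR (ex_piece i) y -> closureR (ex_piece i) z ->
  ex_branch i y = ex_branch i z -> y = z.
Proof. by move=> _ _; rewrite /ex_branch; lra. Qed.

Lemma ex_branch_disj (i j : 'I_M.+1) : i <> j -> forall y z,
  closureR (ex_piece i) y -> closureR (ex_piece j) z ->
  ex_branch i y <> ex_branch j z.
Proof.
move=> ne y z hy hz e; have := ex_branch_sep ne hy hz.
by rewrite e Rminus_diag Rabs_R0; lra.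
Qed.

Lemma ex_orbit_Icc z t : Icc mu ex_b z -> Icc mu ex_b (iter t ex_map z).
Proof. by move=> hz; elim: t => //= t; apply: ex_map_Icc. Qed.

(** The number [m] counts the earlier visits at or beyond [M], each of which subtracts [M]. *)
Lemma ex_orbit_shadows z Y t : Icc mu ex_b z -> shadows z Y ->
  exists m : nat, shadows (iter t ex_map z) (Y + INR t * rho - INR m * INR M).
Proof.
move=> hz hY; elim: t => [|t [m IH]].
  by exists 0%N; rewrite /= !Rmult_0_l Rplus_0_r Rminus_0_r.
have ht := ex_orbit_Icc t hz; have hmu := mu_itv; rewrite iterS.
move/(shadows_step (z := iter t ex_map z)): IH => IH.
have {IH} := IH ltac:(move: ht; rewrite /Icc; lra).
rewrite /ex_map -/ex_map S_INR; case: Rle_dec => h /= IH.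
  exists m.+1; move/(shadows_subn M): IH; congr shadows.
  by rewrite S_INR; ring.
by exists m; move: IH; rewrite Rminus_0_r; congr shadows; ring.
Qed.

Lemma ex_shadow_itv z Y : Icc mu ex_b z -> shadows z Y ->
  rho <= Y <= INR M + rho.
Proof.
move=> hz hY; have [h1 h2] := hz; split; first exact: shadows_le hY h1.
apply: shadows_ge hY _; rewrite Rplus_comm Phi_addn -/mu.
by move: h2; rewrite /ex_b; lra.
Qed.

Lemma ex_orbit_target z u v : Icc mu ex_b z -> u < v ->
  rho < u -> v < INR M + rho -> exists t Y, u < Y < v /\ shadows (iter t ex_map z) Y.
Proof.
move=> hz uv ru vM; have hmu := mu_itv.
have [|Y hY] := @shadows_exists M.+1 z.
  by move: hz; rewrite S_INR /Icc /ex_b; lra.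
have [t [m hm]] := rotation_dense Y M_gt0 uv.
exists t, (Y + INR t * rho + IZR m * INR M); split=> //.
have [k hk] := ex_orbit_shadows t hz hY.
have hI := ex_shadow_itv (ex_orbit_Icc t hz) hk.
(* Both translates lie in an interval of length [M], one of them in its interior, and they differ by
   a multiple of [M]. *)
suff -> : IZR m = - INR k by move: hk; congr shadows; ring.
have e1 : IZR (m + Z.of_nat k - 1) * INR M < 0.
  rewrite minus_IZR plus_IZR -INR_IZR_INZ.
  by move: hm hI; rewrite !Rmult_minus_distr_r Rmult_plus_distr_r; lra.
have e2 : 0 < IZR (m + Z.of_nat k + 1) * INR M.
  rewrite !plus_IZR -INR_IZR_INZ.
  by move: hm hI; rewrite !Rmult_plus_distr_r; lra.
have {}e1 : (m + Z.of_nat k - 1 < 0)%Z.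
  by apply: lt_IZR; apply: (Rmult_lt_reg_r (INR M)); lra.
have {}e2 : (0 < m + Z.of_nat k + 1)%Z.
  by apply: lt_IZR; apply: (Rmult_lt_reg_r (INR M)); lra.
by rewrite INR_IZR_INZ -opp_IZR; congr IZR; lia.
Qed.

Lemma ex_orbit_near z (j : nat) d : Icc mu ex_b z -> (0 < j <= M)%N -> 0 < d ->
  (exists t, INR j - d < iter t ex_map z < INR j) /\
  (exists t, INR j < iter t ex_map z < INR j + d).
Proof.
move=> hz /andP [j0 jM] d0; have hr := rho_itv.
have j1 : 1 <= INR j by have := ltn_INR j0; rewrite /=; lra.
have jM' : INR j <= INR M by apply: le_INR; lia.
(* As [e < rho < 1/2], both windows around [j] lie between [rho] and [M + rho]. *)
have [e [he [e1 e2]]] := Phi_continuous0 d0; split.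
  have [||||t [Y [hY [h1 h2]]]] := @ex_orbit_target z (INR j - e) (INR j); try lra.
    exact: hz.
  exists t; have := h1 (- e + INR j) ltac:(lra); have := h2 (INR j) ltac:(lra).
  by rewrite Phi_addn Phi_INR; lra.
have [||||t [Y [hY [h1 h2]]]] := @ex_orbit_target z (INR j) (INR j + e); try lra.
  exact: hz.
exists t; have := h2 (e + INR j) ltac:(lra); have := h1 (INR j) ltac:(lra).
by rewrite Phi_addn Phi_INR; lra.
Qed.

(** If the orbit of [mu] met an integer, its shadow [(t+1) * rho - m * M] would equal that integer,
    against irrationality. *)
Lemma ex_Xtilde : Xtilde mu ex_b ex_piece ex_map mu.
Proof.
have hmu := mu_itv.
have hm : Icc mu ex_b mu by rewrite /Icc /ex_b; lra.
move=> t; split; first exact: ex_orbit_Icc.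
move=> /ex_Delta [_ [j [_ e]]].
have [m] := ex_orbit_shadows t hm (shadows_Phi rho); rewrite e => hs.
have h1 := shadows_le hs (Req_le _ _ (Phi_INR j)).
have h2 := shadows_ge hs (Req_le _ _ (esym (Phi_INR j))).
apply: (@rho_irr t.+1 (Z.of_nat j + Z.of_nat m * Z.of_nat M)) => //.
by rewrite plus_IZR mult_IZR -!INR_IZR_INZ S_INR; lra.
Qed.

(** * Itineraries of the example *)

Section Itinerary.

Variables (x : R) (theta : nat -> 'I_M.+1).
Hypothesis Ix : Icc mu ex_b x.
Hypothesis Hth : itinerary ex_piece ex_map x theta.

(** Backwards in time the distance doubles, and while it is below [1/4] both points come from the
    same piece. *)
Lemma ex_close_agree n t s :
  Rabs (iter (t + n) ex_map x - iter (s + n) ex_map x) < / 4 * (/ 2) ^ n ->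
  agree theta n t s.
Proof.
elim: n => // n IH; rewrite !addnS /= => h.
have p0 : 0 < (/ 2) ^ n by apply: pow_lt; lra.
have p1 : (/ 2) ^ n <= 1 by rewrite -(pow1 n); apply: pow_incr; lra.
have [Pt Ps] := (Hth (t + n)%N, Hth (s + n)%N).
rewrite -(ex_branchE Pt) -(ex_branchE Ps) in h.
have e : theta (t + n) = theta (s + n).
  case: (eqVneq (theta (t + n)) (theta (s + n))) => // /eqP ne.
  have := ex_branch_sep ne (subset_closureR Pt) (subset_closureR Ps); nra.
apply/agreeS; split=> //; apply: IH; rewrite e /ex_branch in h.
by move/Rabs_def2: h => h; apply: Rabs_def1; lra.
Qed.

Lemma ex_theta t j : INR j < iter t ex_map x < INR j + 1 -> theta t = j :> nat.
Proof.
move=> h; have [_ h'] := Hth t; have [l|l|//] := ltngtP (theta t) j;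
  by have := ltn_INR l; lra.
Qed.

Lemma ex_special n (i : 'I_M.+1) : (0 < i)%N -> special theta val n i.
Proof.
(* Two points within [d] of [i] are closer than the threshold of [ex_close_agree]. *)
move=> i0; pose d := / 8 * (/ 2) ^ n.
have p0 : 0 < (/ 2) ^ n by apply: pow_lt; lra.
have p1 : (/ 2) ^ n <= 1 by rewrite -(pow1 n); apply: pow_incr; lra.
have iM : (0 < i <= M)%N by rewrite i0 -ltnS ltn_ord.
(* Starting from the [n]-th iterate leaves room for [n] letters of past. *)
have [[s hs] [t ht]] := ex_orbit_near (ex_orbit_Icc n Ix) iM (d := d)
  ltac:(rewrite /d; lra).
rewrite -!iterD in hs ht.
have ei : INR i = INR i.-1 + 1 by rewrite -S_INR prednK.
have et : theta (t + n) = i :> nat by apply: ex_theta; rewrite /d in ht; lra.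
have es : theta (s + n) = i.-1 :> nat by apply: ex_theta; rewrite /d in hs; lra.
exists t, s; split; [|exact: val_inj|by rewrite /= es; lia].
by apply: ex_close_agree; apply: Rabs_def1; rewrite /d in hs ht; lra.
Qed.

Lemma ex_complexity n : complexity theta n = (M * n + 1)%N.
Proof.
have rank_lt (i j : 'I_M.+1) y z : (i < j)%N -> ex_piece i y -> ex_piece j z -> y < z.
  by move=> /ltn_INR h [_ hy] [_ hz]; lra.
have past := special_letter_past ex_pc_interval_map ex_branchE ex_branch_cont
  ex_branch_inj ex_branch_disj Ix Hth rank_lt.
elim: n => [|n IH]; first by rewrite complexity0 muln0.
rewrite (complexityS val_inj past) IH.
suff -> : #|special_set theta val n| = M by lia.
apply/eqP; rewrite eqn_leq; apply/andP; split.
  by apply: leq_trans (card_special_set _ _ _) _; rewrite subn1.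
have cM : #|[set~ (ord0 : 'I_M.+1)]| = M by rewrite cardsC1 card_ord.
rewrite -[leqLHS]cM; apply: subset_leq_card; apply/subsetP => i; rewrite !inE => i0.
by apply/asboolP; apply: ex_special; rewrite lt0n.
Qed.

End Itinerary.

End Example.

Theorem theorem1 :
  (forall (a b : R) (N : nat) (P : 'I_N -> R -> Prop) (f : R -> R),
     (2 <= N)%N ->
     pc_interval_map a b P f ->
     separation P f ->
     forall x : R, Xtilde a b P f x ->
     forall theta : nat -> 'I_N, itinerary P f x theta ->
     exists alpha beta m0 : nat,
       (alpha <= N - 1)%N /\ (1 <= beta)%N /\ (1 <= m0)%N /\
       (forall n : nat, (m0 <= n)%N -> complexity theta n = (alpha * n + beta)%N) /\
       (alpha = (N - 1)%N -> beta = 1%N))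
  /\
  (forall N : nat, (2 <= N)%N ->
     exists (a b : R) (P : 'I_N -> R -> Prop) (f : R -> R),
       pc_interval_map a b P f /\
       separation P f /\
       piecewise_affine P f /\
       (exists x : R, Xtilde a b P f x) /\
       (forall (x : R) (theta : nat -> 'I_N),
          Xtilde a b P f x -> itinerary P f x theta ->
          forall n : nat, (1 <= n)%N ->
            complexity theta n = ((N - 1) * n + 1)%N)).
Proof.
split=> [a b N P f _ Hpc [g [gf [gc [gi gs]]]] x Hx theta Hth|].
  have [rank [rank_inj rank_lt]] := pieces_ordered Hpc.
  have past := special_letter_past Hpc gf gc gi gs (proj1 (Hx 0%N)) Hth rank_lt.
  apply: (@eventually_affine _ (fun n => #|special_set theta rank n|)).
  - exact: complexity0.
  - exact: complexityS.
  - by move=> n; apply: subset_leq_card; apply: special_setS.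
  - exact: card_special_set.
case=> // M M1; rewrite subn1 /=.
exists mu, (ex_b M), (@ex_piece M), (ex_map M); split; first exact: ex_pc_interval_map.
split.
  exists (@ex_branch M); split; first exact: ex_branchE.
  split; first exact: ex_branch_cont.
  by split; [exact: ex_branch_inj|exact: ex_branch_disj].
split.
  move=> i; exists (/ 2), (INR i / 2 + mu - (if i == M :> nat then INR M else 0)).
  by move=> x /ex_branchE <- //; rewrite /ex_branch; field.
split; first by exists mu; apply: ex_Xtilde.
by move=> x theta Hx Hth n _; apply: ex_complexity Hth _ => //; case: (Hx 0%N).
Qed.
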